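(* Let $k\ge1$ and let $L_1,\dots,L_k$ be non-negative integers with $L_1L_k\ne0$. Assume that the polynomial $L_kX^k+\dots+L_1X-1$ has no multiple roots, that its unique positive root $\beta=\beta_1$ satisfies $0<\beta<1$, and that all its other complex roots $\beta_2,\dots,\beta_k$ satisfy $|\beta_j|>1$. Let $(\xi_{L_1,\dots,L_k}^n)_{n\in\mathbb N}$ be the generalized $LS$-sequence of points and let $\lambda_{j,i}$ ($1\le j\le k$, $0\le i\le k$) be the constants defined in the context. Put, for $j=2,\dots,k$, $$\Lambda_j=\max_{\ell=2,\dots,k}\left\{\frac{\sum_{i=1}^{\ell}|\lambda_{j,i}|+(L_1+\dots+L_k-2)|\lambda_{j,1}|}{1-|\beta_j|^{-1}}\right\},$$ $$\tilde R=1+|\lambda_{1,0}|+\sum_{j=2}^k\left(2\Lambda_j+|\lambda_{j,0}|\right).$$ Then for all sufficiently large $N$ $$D_N(\xi_{L_1,\dots,L_k}^{1},\ldots,\xi_{L_1,\dots,L_k}^{N})\le\frac{\log(N+1)-\log|\lambda_{1,0}\beta^k|}{N|\log\beta|}\,(2L_1+L_2+\dots+L_k-2)\,\tilde R .$$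
   Context: Discrepancy: for $x_1,\dots,x_N\in[0,1]$, $$D_N(x_1,\dots,x_N)=\sup_{0\le a<b\le 1}\left|\frac1N\sum_{n=1}^N\mathbf 1_{[a,b)}(x_n)-(b-a)\right|.$$ The numbers $l_{n,i}$ and $t_n$. Put $l_{0,1}=1$, $l_{0,2}=\dots=l_{0,k}=0$, $l_{n,j}=0$ for $j>k$, and for $n\ge1$, $1\le i\le k$, $$l_{n,i}=l_{n-1,i+1}+L_il_{n-1,1}.$$ Put $t_n=l_{n,0}=l_{n,1}+\dots+l_{n,k}$. (Here $l_{n,i}$ is the number of intervals of length $\beta^{n+i-1}$, and $t_n$ the total number of intervals, in the partition of $[0,1)$ obtained from $\{[0,1)\}$ by $n$ times subdividing all intervals of maximal length homothetically into $L_1$ intervals of relative length $\beta$, followed by $L_2$ of relative length $\beta^2$, ..., followed by $L_k$ of relative length $\beta^k$.) The constants $\lambda_{j,i}$ are the unique complex numbers with $l_{n,i}=\sum_{j=1}^k\lambda_{j,i}\beta_j^{-n}$ for all $n\ge0$ and $0\le i\le k$. Digits. Every integer $N\ge1$ gets digits $(\epsilon_i,\eta_i)_{0\le i\le n}$ as follows. Let $n$ be such that $t_n\le N<t_{n+1}$; put $N_n=N$, $T_n=t_n$, $\epsilon_n=1$, $\eta_n=\lfloor(N-T_n)/l_{n,1}\rfloor$. For $m=n-1,\dots,0$: let $j\ge0$ be the unique integer with $\epsilon_{m+1}=\dots=\epsilon_{m+j}=0$ and $\epsilon_{m+j+1}\ne0$; put $N_m=N_{m+1}-\epsilon_{m+1}T_{m+1}-\eta_{m+1}l_{m+1,1}$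 and $T_m=l_{m,1}+\dots+l_{m,j+2}$; if $N_m<T_m$ put $\epsilon_m=\eta_m=0$, otherwise put $\epsilon_m=1$ and $\eta_m=\lfloor(N_m-T_m)/l_{m,1}\rfloor$. Generalized $LS$-sequence of points. With $S_0=0$, $S_r=L_1+\dots+L_r$ and $e_i=\epsilon_i+\eta_i$ (one has $0\le e_i\le S_k-1$), $$\xi_{L_1,\dots,L_k}^N=\sum_{i=0}^n\sum_{r=1}^k\beta^{i+r}\left(\max\{e_i-S_{r-1},0\}-\max\{e_i-S_r,0\}\right).$$ *)

(* Defs.v *)
From HB Require Import structures.
From mathcomp Require Import all_boot all_order all_algebra.
From mathcomp Require Import all_classical all_reals all_analysis.
From mathcomp Require Import complex.

Set Implicit Arguments.
Unset Strict Implicit.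
Unset Printing Implicit Defensive.

Import Order.TTheory GRing.Theory Num.Theory.
Import numFieldNormedType.Exports.

Local Open Scope classical_set_scope.
Local Open Scope ring_scope.

(* The norm `|z| of z : R[i] lives in R[i]; this is the modulus as an element
   of R, and `|z| = (cmod z)%:C holds by conversion. *)
Notation cmod := ComplexField.Normc.normc.

Definition discrepancy (R : realType) (N : nat) (x : nat -> R) : R :=
  sup [set d | exists a b : R, [/\ 0 <= a, a < b, b <= 1 &
         d = `| N%:R^-1 * (\sum_(1 <= n < N.+1) (x n \in `[a, b[)%:R)
                - (b - a) | ]].

(* In all that follows the parameters are L 1, ..., L k; other values of L
   are never used. *)

Fixpoint lpos (k : nat) (L : nat -> nat) (n i : nat) : nat :=
  match n with
  | 0%N => i == 1%N
  | n'.+1 => if (0 < i <= k)%N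
             then (lpos k L n' i.+1 + L i * lpos k L n' 1)%N else 0%N
  end.

Definition tnum (k : nat) (L : nat -> nat) (n : nat) : nat :=
  (\sum_(1 <= i < k.+1) lpos k L n i)%N.

(* l_{n,i}, with the convention l_{n,0} = t_n. *)
Definition lnum (k : nat) (L : nat -> nat) (n i : nat) : nat :=
  if i is 0%N then tnum k L n else lpos k L n i.

(* When L 1 >= 1 and L 1 + ... + L k >= 2, the sequence t is strictly increasing
   from t_0 = 1; hence t_m <= N forces m < N, and for N >= 1 this is the n with
   t_n <= N < t_{n+1}. *)
Definition level (k : nat) (L : nat -> nat) (N : nat) : nat :=
  (\max_(m < N | tnum k L m <= N) m)%N.

(* Data attached to a position m.  ds_run is the number of consecutive zeros
   among eps_m, eps_{m+1}, ..., starting from eps_m; it is the integer j used at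
   position m - 1. *)
Record digit_state := DigitState {
  ds_N : nat;
  ds_T : nat;
  ds_eps : nat;
  ds_eta : nat;
  ds_run : nat
}.

Definition digit_init (k : nat) (L : nat -> nat) (N n : nat) : digit_state :=
  let T := tnum k L n in
  DigitState N T 1 ((N - T) %/ lnum k L n 1) 0.

(* From the data at position m.+1 to the data at position m. *)
Definition digit_step (k : nat) (L : nat -> nat) (m : nat) (s : digit_state) :
    digit_state :=
  let N := (ds_N s - ds_eps s * ds_T s - ds_eta s * lnum k L m.+1 1)%N in
  let j := ds_run s in
  let T := (\sum_(1 <= i < j.+3) lnum k L m i)%N in
  if (N < T)%N then DigitState N T 0 0 j.+1
  else DigitState N T 1 ((N - T) %/ lnum k L m 1) 0.

(* Data at position n - d, where n = level k L N. *)
Fixpoint digit_iter (k : nat) (L : nat -> nat) (N d : nat) : digit_state :=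
  let n := level k L N in
  match d with
  | 0%N => digit_init k L N n
  | d'.+1 => digit_step k L (n - d) (digit_iter k L N d')
  end.

(* e_i = eps_i + eta_i, for 0 <= i <= level k L N. *)
Definition digit (k : nat) (L : nat -> nat) (N i : nat) : nat :=
  let s := digit_iter k L N (level k L N - i) in (ds_eps s + ds_eta s)%N.

Definition Lsum (L : nat -> nat) (r : nat) : nat :=
  (\sum_(1 <= i < r.+1) L i)%N.

(* The truncated subtraction (e - s)%N is max {e - s, 0}. *)
Definition LSpoint (R : realType) (k : nat) (L : nat -> nat) (b : R) (N : nat) :
    R :=
  \sum_(0 <= i < (level k L N).+1) \sum_(1 <= r < k.+1)
    b ^+ (i + r) * ((digit k L N i - Lsum L r.-1)%:R
                    - (digit k L N i - Lsum L r)%:R).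

Definition LSpoly (R : realType) (k : nat) (L : nat -> nat) : {poly R[i]} :=
  \sum_(1 <= i < k.+1) (L i)%:R *: 'X^i - 1.

Section Constants.
Variables (R : realType) (k : nat) (L : nat -> nat).
Variables (beta : nat -> R[i]) (lambda : nat -> nat -> R[i]).

Definition Lambda_term (j l : nat) : R :=
  (\sum_(1 <= i < l.+1) cmod (lambda j i)
   + ((Lsum L k)%:R - 2) * cmod (lambda j 1%N)) / (1 - (cmod (beta j))^-1).

(* Only used for 2 <= j <= k, when the range of l is nonempty and contains the
   default value l = 2. *)
Definition Lambda (j : nat) : R :=
  \big[Num.max/Lambda_term j 2%N]_(2 <= l < k.+1) Lambda_term j l.

Definition Rtilde : R :=
  1 + cmod (lambda 1%N 0%N) + \sum_(2 <= j < k.+1) (2 * Lambda j + cmod (lambda j 0%N)).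

End Constants.

(* Main.v *)
Require Import Defs.
From HB Require Import structures.
From mathcomp Require Import all_boot all_order all_algebra.
From mathcomp Require Import all_classical all_reals all_analysis.
From mathcomp Require Import complex.
From mathcomp Require Import zify ring lra.

Set Implicit Arguments.
Unset Strict Implicit.
Unset Printing Implicit Defensive.

Import Order.TTheory GRing.Theory Num.Theory.
Import numFieldNormedType.Exports.

Local Open Scope classical_set_scope.
Local Open Scope ring_scope.

(* Reading the digits of an index from the lowest one upwards locates the point
   [xi^N] in successive subdivisions, so the points of an interval of length
   [b ^+ p] of some partition are the indices with [p] prescribed lowest digits;
   reading them from the highest one downwards counts these indices.  Comparing
   this count with [N * b ^+ p], the contributions of [b] cancel and those of the
   other [beta j] sum geometrically: the error is at most [E := Rtilde - 1].
   An interval [0, x) is cut greedily into such intervals.  A step that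
   takes [e] pieces, [S_{r-1} <= e < S_r], descends [r] levels, and [e <= S_r - 1 <= r * F / 2] with
   [F = 2 L_1 + L_2 + ... + L_k - 2]; two endpoints thus cost [F * E] per level,
   and the spare [F] per level absorbs all the constants for large [N]. *)

(** * Elementary inequalities for counting errors *)

(** For a part of an interval: its true count [c'] and its expected count [y] lie between 0 and
    those of the whole, which expects at most [C]. *)
Lemma ler_norm_sub_part (R : realType) (c c' y z E C : R) :
  0 <= E -> `|c - z| <= E -> 0 <= c' <= c -> 0 <= y <= z -> z <= C ->
  `|c' - y| <= E + C.
Proof.
rewrite !ler_norml => E0 /andP[_ cz] /andP[c0 cc] /andP[y0 yz] zC.
by apply/andP; split; lra.
Qed.

Lemma ler_norm_sub_itv (R : realType) (x y r : R) :
  0 <= x <= r -> 0 <= y <= r -> `|x - y| <= r.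
Proof.
by rewrite ler_norml => /andP[? ?] /andP[? ?]; apply/andP; split; lra.
Qed.

(** [x] and [y] count indices from 0 to [N]. Index 0 has the point 0, which lies in [[0, c)] always
    and in [[0, a)] exactly when [0 < a]. Removing it and replacing [N + 1] by [N] costs at most 1
    in all. *)
Lemma local_discrepancy_combine (R : realType) (x y N a c B : R) :
    `|x - (N + 1) * c| <= B -> `|y - (N + 1) * a| <= B ->
    0 <= a -> a < c -> c <= 1 ->
  `|x - 1 - (y - (0 < a)%R%:R) - N * (c - a)| <= 2 * B + 1.
Proof.
rewrite !ler_norml => /andP[x1 x2] /andP[y1 y2] a0 ac c1.
have [a_gt0|a_le0] := ltP 0 a; apply/andP; split; rewrite ?mulr1n ?mulr0n; lra.
Qed.

(** * Lists made of consecutive relabelled copies of one block *)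

Section Blocks.
Local Open Scope nat_scope.
Variables (T : eqType) (U : Type) (g : nat -> T -> U) (B : seq T).

Lemma nth_blocks (x0 : U) (y0 : T) (s a N : nat) : N < s * size B ->
  nth x0 [seq g e w | e <- iota a s, w <- B] N
  = g (a + N %/ size B) (nth y0 B (N %% size B)).
Proof.
elim: s a N => [|s IHs] a N; first by rewrite mul0n.
move=> ltN; have B_gt0 : 0 < size B by case: (size B) ltN; rewrite ?muln0.
rewrite /= nth_cat size_map; case: ltnP => leN.
  by rewrite divn_small // modn_small // addn0 (nth_map y0).
rewrite IHs; last by move: ltN; rewrite mulSn; lia.
have -> : N %/ size B = (N - size B) %/ size B + 1.
  by rewrite -[in LHS](subnK leN) divnDr // divnn B_gt0.
have -> : N %% size B = (N - size B) %% size B.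
  by rewrite -[in LHS](subnK leN) modnDr.
by rewrite addSnnS addn1.
Qed.

Lemma count_blocks (P : pred U) (P' : pred T) (s a : nat) :
  (forall e, {in B, forall w, P (g e w) = P' w}) ->
  count P [seq g e w | e <- iota a s, w <- B] = s * count P' B.
Proof.
move=> PP'; elim: s a => [|s IHs] a //=.
by rewrite count_cat IHs count_map (eq_in_count (PP' a)) mulSn.
Qed.

(** Taking [N.+1] entries rather than [N] lets the same quotient and remainder of [N] locate the
    last entry and count the whole blocks before it. *)
Lemma count_take_blocks (P : pred U) (P' : pred T) (s a N : nat) :
  (forall e, {in B, forall w, P (g e w) = P' w}) -> N < s * size B ->
  count P (take N.+1 [seq g e w | e <- iota a s, w <- B])
  = N %/ size B * count P' B + count P' (take (N %% size B).+1 B).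
Proof.
move=> PP'; elim: s a N => [|s IHs] a N; first by rewrite mul0n.
move=> ltN; have B_gt0 : 0 < size B by case: (size B) ltN; rewrite ?muln0.
have [leN|ltBN] := ltnP N (size B).
  rewrite /= takel_cat ?size_map // -map_take count_map.
  rewrite (eq_in_count (a2 := P')); last by move=> w /mem_take; exact: PP'.
  by rewrite divn_small // modn_small // mul0n.
rewrite /= take_cat size_map ltnNge (leqW ltBN) /= subSn // count_cat.
rewrite count_map (eq_in_count (PP' a)) IHs; last by move: ltN; rewrite mulSn; lia.
have -> : N %/ size B = (N - size B) %/ size B + 1.
  by rewrite -[in LHS](subnK ltBN) divnDr // divnn B_gt0.
have -> : N %% size B = (N - size B) %% size B.
  by rewrite -[in LHS](subnK ltBN) modnDr.
by rewrite mulnDl mul1n; lia.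
Qed.

End Blocks.

(** * Partial sums of the interval numbers *)

Section LSsequence.
Local Open Scope nat_scope.
Variables (k : nat) (L : nat -> nat).
Hypotheses (k_gt0 : 0 < k) (L1_gt0 : 0 < L 1).

(** The cap makes these sums constant beyond [k], as if [L i = 0] for [i > k]. *)
Definition Lcum (j : nat) : nat := Lsum L (minn j k).

Definition lcum (m j : nat) : nat := \sum_(1 <= i < j.+1) lpos k L m i.

Lemma lpos_gt_k (m i : nat) : k < i -> lpos k L m i = 0.
Proof.
move=> ki; case: m => [|m] /=; first by case: i ki => [|[|i]] //; lia.
by rewrite [i <= k]leqNgt ki andbF.
Qed.

Lemma LsumS (r : nat) : Lsum L r.+1 = Lsum L r + L r.+1.
Proof. by rewrite /Lsum big_nat_recr. Qed.

Lemma leq_Lsum : {homo Lsum L : m n / m <= n}.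
Proof.
by apply: homo_leq => // [y x z|n]; [exact: leq_trans | rewrite LsumS leq_addr].
Qed.

Lemma leq_Lcum : {homo Lcum : m n / m <= n}.
Proof.
move=> m n mn; apply: leq_Lsum; rewrite leq_min geq_minr andbT.
exact: leq_trans (geq_minl _ _) mn.
Qed.

Lemma Lcum_leq_k (j : nat) : Lcum j <= Lcum k.
Proof. by apply: leq_Lsum; rewrite minnn geq_minr. Qed.

Lemma Lcum_gt0 (j : nat) : 0 < j -> 0 < Lcum j.
Proof.
move=> j0; apply: (@leq_trans (Lsum L 1)); last by apply: leq_Lsum; lia.
by rewrite /Lsum big_nat1.
Qed.

Lemma lcumS (m j : nat) : lcum m j.+1 = lcum m j + lpos k L m j.+1.
Proof. by rewrite /lcum big_nat_recr. Qed.

Lemma lcum1 (m : nat) : lcum m 1 = lpos k L m 1.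
Proof. by rewrite /lcum big_nat1. Qed.

(** The recurrence summed over [i <= j]; the term [i = 1] missing from the shifted sum stands on the
    left to avoid truncated subtraction. *)
Lemma lcum_rec (m j : nat) :
  lcum m.+1 j + lpos k L m 1 = lcum m j.+1 + Lcum j * lpos k L m 1.
Proof.
elim: j => [|j IHj].
  by rewrite lcum1 /lcum /Lcum min0n /Lsum !big_nil /= add0n mul0n addn0.
rewrite lcumS [lcum m j.+2]lcumS /Lcum; have [jk|kj] := leqP j.+1 k.
  have Lj : minn j k = j by lia.
  by move: IHj; rewrite /Lcum Lj LsumS /= jk mulnDl; lia.
have Lj : minn j k = k by lia.
move: IHj; rewrite /Lcum Lj !(@lpos_gt_k _ j.+2) ?(@lpos_gt_k _ j.+1) //; lia.
Qed.

Lemma lcum_geq_k (m j : nat) : k <= j -> lcum m j = tnum k L m.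
Proof.
elim: j => [|j IHj]; first by case: (k) k_gt0.
rewrite leq_eqVlt => /orP[/eqP <- //|kj].
by rewrite lcumS IHj // lpos_gt_k // addn0.
Qed.

Lemma lcum_minn (m j : nat) : lcum m (minn j k) = lcum m j.
Proof.
have [//|kj] := leqP j k.
by rewrite !lcum_geq_k // ltnW.
Qed.

Lemma leq_lcum_tnum (m j : nat) : lcum m j <= tnum k L m.
Proof.
rewrite -(@lcum_geq_k m (maxn j k)) ?leq_maxr //.
have : j <= maxn j k by exact: leq_maxl.
elim: (maxn j k) => [|p IHp]; first by case: j.
rewrite leq_eqVlt => /orP[/eqP -> //|jp].
by rewrite lcumS (leq_trans (IHp jp)) // leq_addr.
Qed.

(** * Digit words of the partition intervals *)

(* [words m j] lists, in the order of their indices, the digit words (lowest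
   digit first) of the left endpoints of those intervals of the [m]-th partition
   that have length [b ^+ m], ..., [b ^+ (m + j - 1)]. *)
Fixpoint words (m j : nat) : seq (seq nat) :=
  if m is m'.+1 then
    [seq rcons w 0 | w <- words m' j.+1]
      ++ [seq rcons w e | e <- iota 1 (Lcum j).-1, w <- words m' 1]
  else [:: [::]].

Lemma size_words (m j : nat) : 0 < j -> size (words m j) = lcum m j.
Proof.
elim: m j => [|m IHm] j j0.
  rewrite /= /lcum big_ltn // big_nat_cond big1 ?addn0 //.
  by case=> [|[|i]].
rewrite /= size_cat size_map size_allpairs size_iota !IHm // lcum1.
by have := lcum_rec m j; have := Lcum_gt0 j0; case: (Lcum j) => //= S _; lia.
Qed.

Lemma words_size (m j : nat) (v : seq nat) : v \in words m j -> size v = m.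
Proof.
elim: m j v => [|m IHm] j v /=; first by rewrite inE => /eqP ->.
rewrite mem_cat => /orP[/mapP[w /IHm <- ->]|]; first by rewrite size_rcons.
by case/allpairsP => [[e w]] [/= _ /IHm <- ->]; rewrite size_rcons.
Qed.

Lemma mem_words_rcons (m j : nat) (v : seq nat) : v \in words m.+1 j ->
  (exists2 w, w \in words m j.+1 & v = rcons w 0) \/
  (exists w e, [/\ w \in words m 1, 0 < e < Lcum j & v = rcons w e]).
Proof.
rewrite /= mem_cat => /orP[/mapP[w wW ->]|]; first by left; exists w.
case/allpairsP => [[e w]] [/= eI wW ->]; right; exists w, e; split=> //.
by move: eI; rewrite mem_iota; lia.
Qed.

Lemma leq_words (m i j : nat) : i <= j -> {subset words m i <= words m j}.
Proof.
elim: m i j => [|m IHm] i j ij v //=; rewrite !mem_cat.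
case/orP => [/mapP[w wW ->]|/allpairsP[[e w]] [/= eI wW ->]]; apply/orP.
  by left; apply: map_f; apply: IHm wW.
right; apply/allpairsP; exists (e, w); split=> //=.
by move: eI; rewrite !mem_iota; have := leq_Lcum ij; lia.
Qed.

Lemma rcons0_words (m j : nat) (w : seq nat) :
  w \in words m j.+1 -> rcons w 0 \in words m.+1 j.
Proof.
by move=> wW; rewrite /= mem_cat; apply/orP; left; apply: (map_f (rcons^~ 0)).
Qed.

Lemma rcons_words (m j e : nat) (w : seq nat) :
  w \in words m 1 -> e < Lcum j -> rcons w e \in words m.+1 j.
Proof.
case: e => [|e] wW ej; first by apply/rcons0_words/leq_words/wW.
rewrite /= mem_cat; apply/orP; right; apply/allpairsP; exists (e.+1, w).
by split=> //=; rewrite mem_iota; lia.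
Qed.

Lemma words_uniq (m j : nat) : uniq (words m j).
Proof.
elim: m j => [|m IHm] j //=.
rewrite cat_uniq map_inj_uniq ?IHm /=; last by move=> x y /rcons_inj[].
apply/andP; split; last first.
  apply: allpairs_uniq; rewrite ?iota_uniq // => -[e w] [e' w'] _ _ /=.
  by move=> /rcons_inj[-> ->].
apply/hasPn => v /allpairsP[[e w]] [/= eI _ ->]; apply/mapP => -[w' _].
by move=> /rcons_inj[_ e0]; move: eI; rewrite e0 mem_iota.
Qed.

(** * Counting words with a prescribed prefix *)

Lemma take_rcons_le (p e : nat) (w : seq nat) : p <= size w ->
  take p (rcons w e) = take p w.
Proof. by move=> pw; rewrite -cats1 takel_cat. Qed.

Lemma take_rcons_words (p m j : nat) (u : seq nat) (e : nat) : p <= m ->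
  {in words m j, forall w, (take p (rcons w e) == u) = (take p w == u)}.
Proof. by move=> pm w /words_size sw; rewrite take_rcons_le ?sw. Qed.

(** Self-similarity: an interval of length [b ^+ p] of the partition number [p] is refined like
    [[0, 1)] itself, so the count obeys the recurrence of [lcum d]. *)
Lemma count_prefix_words (p d j : nat) (u : seq nat) :
    0 < j -> u \in words p 1 ->
  count (fun v => take p v == u) (words (p + d) j) = lcum d j.
Proof.
move=> + uW; elim: d j => [|d IHd] j j0.
  rewrite addn0 -(size_words 0 j0) /=.
  rewrite (eq_in_count (a2 := pred1 u)); last first.
    by move=> v /words_size sv /=; rewrite -sv take_size.
  by rewrite count_uniq_mem ?words_uniq // (leq_words j0 uW).
rewrite addnS /= count_cat count_map.
rewrite (eq_in_count (take_rcons_words (j := j.+1) u 0 (leq_addr d p))) IHd //.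
rewrite (count_blocks _ _ (P' := fun v => take p v == u)); last first.
  by move=> e; apply: take_rcons_words; rewrite leq_addr.
rewrite IHd // lcum1.
by have := lcum_rec d j; have := Lcum_gt0 j0; case: (Lcum j) => //= S _; lia.
Qed.

Lemma take_words_step (m j N : nat) : 0 < j -> N < lcum m j.+1 ->
  take N.+1 (words m.+1 j) = [seq rcons w 0 | w <- take N.+1 (words m j.+1)].
Proof.
by move=> j0 ltN; rewrite /= takel_cat ?map_take // size_map size_words.
Qed.

(** Removes the highest digit: first come all words with highest digit 0, then [M %/ l] complete
    blocks with a fixed nonzero one, then the start of a further block. *)
Lemma count_take_prefix_step (p d j N : nat) (u : seq nat) :
    0 < j -> u \in words p 1 -> lcum (p + d) j.+1 <= N < lcum (p + d).+1 j ->
  let M := N - lcum (p + d) j.+1 in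
  let l := lpos k L (p + d) 1 in
  count (fun v => take p v == u) (take N.+1 (words (p + d).+1 j))
  = lcum d j.+1 + M %/ l * lpos k L d 1
    + count (fun v => take p v == u) (take (M %% l).+1 (words (p + d) 1)).
Proof.
move=> j0 uW /andP[leN ltN] /=.
rewrite take_cat size_map size_words // ltnNge (leqW leN) /= subSn // count_cat.
rewrite count_map.
rewrite (eq_in_count (take_rcons_words (j := j.+1) u 0 (leq_addr d p))).
rewrite count_prefix_words //.
rewrite (count_take_blocks (P' := fun v => take p v == u)); first last.
- rewrite size_words // lcum1.
  by have := lcum_rec (p + d) j; have := Lcum_gt0 j0; case: (Lcum j) => //=; lia.
- by move=> e; apply: take_rcons_words; rewrite leq_addr.
by rewrite count_prefix_words // size_words // !lcum1 addnA.
Qed.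

(** * The level of an index and the digit algorithm *)

Lemma nth_words_lt (m j N : nat) : 0 < j -> N < lcum m j.+1 ->
  nth [::] (words m.+1 j) N = rcons (nth [::] (words m j.+1) N) 0.
Proof.
move=> j0 ltN; rewrite /= nth_cat size_map size_words // ltN.
by rewrite (nth_map [::]) // size_words.
Qed.

Lemma nth_words_geq (m j N : nat) : 0 < j ->
    lcum m j.+1 <= N < lcum m.+1 j ->
  let M := N - lcum m j.+1 in
  let l := lpos k L m 1 in
  nth [::] (words m.+1 j) N = rcons (nth [::] (words m 1) (M %% l)) (M %/ l).+1.
Proof.
move=> j0 /andP[leN ltN] /=.
rewrite nth_cat size_map size_words // ltnNge leN /=.
rewrite (nth_blocks _ [::] [::]) ?size_words // lcum1 //.
by have := lcum_rec m j; have := Lcum_gt0 j0; case: (Lcum j) => //=; lia.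
Qed.

Lemma lpos1_gt0 (m : nat) : 0 < lpos k L m 1.
Proof.
by elim: m => //= m IHm; rewrite k_gt0 addn_gt0 muln_gt0 L1_gt0 IHm orbT.
Qed.

Lemma tnum0 : tnum k L 0 = 1.
Proof. exact: esym (size_words 0 k_gt0). Qed.

Lemma tnumS (m : nat) :
  tnum k L m.+1 + lpos k L m 1 = tnum k L m + Lsum L k * lpos k L m 1.
Proof. by have := lcum_rec m k; rewrite !lcum_geq_k // /Lcum minnn. Qed.

Lemma ltn_tnum (m : nat) : 1 < Lsum L k -> m < tnum k L m.
Proof.
move=> S_gt1; elim: m => [|m IHm]; first by rewrite tnum0.
have := tnumS m; have := lpos1_gt0 m; move: IHm S_gt1.
by move: (tnum k L m) (tnum k L m.+1) (Lsum L k) (lpos k L m 1); nia.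
Qed.

Lemma level_spec (N : nat) : 1 < Lsum L k -> 0 < N ->
  tnum k L (level k L N) <= N < tnum k L (level k L N).+1.
Proof.
move=> S_gt1 N_gt0; apply/andP; split.
  (* The default value 0 of an empty maximum is covered by [t_0 = 1 <= N]. *)
  apply: (big_ind (fun x => tnum k L x <= N)) => // [|x y].
    by rewrite tnum0.
  by rewrite /maxn; case: ifP.
rewrite ltnNge; apply/negP => leN.
(* Since [m < t_m], the number [level + 1] would be below [N] and so compete in the maximum. *)
have ltN := leq_trans (ltn_tnum (level k L N).+1 S_gt1) leN.
have := @leq_bigmax_cond _ (fun m : 'I_N => tnum k L m <= N) (@nat_of_ord N)
  (Ordinal ltN) leN.
by rewrite /= ltnn.
Qed.

Lemma level_geq (N n : nat) : 1 < Lsum L k -> tnum k L n <= N -> n <= level k L N.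
Proof.
move=> S_gt1 leN; have ltN := leq_trans (ltn_tnum n S_gt1) leN.
exact: (@leq_bigmax_cond _ (fun m : 'I_N => tnum k L m <= N) (@nat_of_ord N)
  (Ordinal ltN) leN).
Qed.

Lemma words_geq_k (m j : nat) : k <= j -> words m j = words m k.
Proof.
elim: m j => [|m IHm] j kj //=.
by rewrite IHm ?(IHm k.+1) ?leqW // /Lcum (minn_idPr kj) minnn.
Qed.

Lemma leq_tnumD (m d : nat) : tnum k L m <= tnum k L (m + d).
Proof.
elim: d => [|d IHd]; rewrite ?addn0 // addnS (leq_trans IHd) //.
have := tnumS (m + d); have := Lcum_gt0 k_gt0; rewrite /Lcum minnn.
by case: (Lsum L k) => // S _; nia.
Qed.

(** Words with highest digit 0 are listed first, so an index keeps its word in all finer partitions,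
    up to trailing zeros. *)
Lemma nth_words_pad (m d N : nat) : N < tnum k L m ->
  nth [::] (words (m + d) k) N = nth [::] (words m k) N ++ nseq d 0.
Proof.
move=> ltN; elim: d => [|d IHd]; first by rewrite addn0 cats0.
rewrite addnS nth_words_lt //; last first.
  by rewrite lcum_geq_k ?leqnSn // (leq_trans ltN) // leq_tnumD.
rewrite words_geq_k ?leqnSn // IHd rcons_cat; congr (_ ++ _).
by elim: d {IHd} => //= d ->.
Qed.

(* The digits below position [m] produced by the algorithm from the data [s] at
   position [m]. *)
Fixpoint lower_digits (m : nat) (s : digit_state) : seq nat :=
  if m is m'.+1 then
    let s' := digit_step k L m' s in
    rcons (lower_digits m' s') (ds_eps s' + ds_eta s')
  else [::].

(** Invariant of the algorithm: what remains of the index is the rank of the remaining word among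
    those of the first [ds_run s + 1] types. A digit 0 admits one more type at the next lower
    position, a nonzero digit only type 1. *)
Lemma lower_digitsE (m : nat) (s : digit_state) :
  let N := ds_N s - ds_eps s * ds_T s - ds_eta s * lpos k L m 1 in
  N < lcum m (ds_run s).+1 ->
  lower_digits m s = nth [::] (words m (ds_run s).+1) N.
Proof.
elim: m s => [|m IHm] s /=.
  by rewrite -(@size_words 0) //=; case: (_ - _).
set N := (X in X < _) => ltN.
have eqT : \sum_(1 <= i < (ds_run s).+3) lnum k L m i = lcum m (ds_run s).+2.
  by apply: eq_big_nat => -[].
rewrite /digit_step /= eqT -/N; case: ltnP => NT.
  rewrite IHm /= !mul0n !subn0 //; by rewrite -nth_words_lt.
have := nth_words_geq (m := m) (j := (ds_run s).+1) (N := N) isT.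
rewrite NT => /(_ ltN) /= ->.
(* Removing [T] and [eta] complete blocks leaves the rank within a single block. *)
have modE : N - 1 * lcum m (ds_run s).+2
    - (N - lcum m (ds_run s).+2) %/ lpos k L m 1 * lpos k L m 1
    = (N - lcum m (ds_run s).+2) %% lpos k L m 1.
  by rewrite mul1n {1}(divn_eq (N - lcum _ _) (lpos k L m 1)) addKn.
by rewrite IHm /= modE // lcum1 ltn_pmod ?lpos1_gt0.
Qed.

(** Reconciles two indexings: [lower_digits] recurses on the position, [digit_iter] on the distance
    from the level. *)
Lemma lower_digits_iter (N d : nat) : d <= level k L N ->
  lower_digits (level k L N - d) (digit_iter k L N d)
  = [seq digit k L N i | i <- iota 0 (level k L N - d)].
Proof.
set n := level k L N => dn; rewrite -{2}(subKn dn).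
elim: (n - d) (leq_subr d n) => [|m IHm] mn //.
have dE : n - m = (n - m.+1).+1 by lia.
rewrite [LHS]/=.
have -> : digit_step k L m (digit_iter k L N (n - m.+1)) = digit_iter k L N (n - m).
  rewrite dE /= -/n; congr (digit_step _ _ _ _); lia.
rewrite IHm ?(ltnW mn) // -[in RHS](addn1 m) iotaD map_cat /= cats1; congr rcons.
Qed.

Lemma nth_words_digit (N : nat) : 1 < Lsum L k -> 0 < N ->
  nth [::] (words (level k L N).+1 k) N
  = [seq digit k L N i | i <- iota 0 (level k L N).+1].
Proof.
move=> S_gt1 N_gt0; have /andP[leN ltN] := level_spec S_gt1 N_gt0.
set n := level k L N in leN ltN *.
rewrite -[in RHS](addn1 n) iotaD map_cat cats1 add0n.
have TE : lcum n k.+1 = tnum k L n by rewrite lcum_geq_k.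
have := nth_words_geq (m := n) (j := k) (N := N) k_gt0.
rewrite TE (lcum_geq_k n.+1 (leqnn k)) leN ltN => /(_ isT) /= ->.
have := lower_digits_iter (leq0n (level k L N)).
rewrite -/n subn0 => nE.
have modE : N - 1 * tnum k L n - (N - tnum k L n) %/ lpos k L n 1 * lpos k L n 1
    = (N - tnum k L n) %% lpos k L n 1.
  by rewrite mul1n {1}(divn_eq (N - tnum _ _ _) (lpos k L n 1)) addKn.
have : lower_digits n (digit_iter k L N 0)
    = nth [::] (words n 1) ((N - tnum k L n) %% lpos k L n 1).
  by rewrite lower_digitsE /= -/n modE // lcum1 ltn_pmod ?lpos1_gt0.
rewrite nE => <-; congr rcons.
by rewrite /digit -/n subnn /= add1n.
Qed.

(** * Types of digits and of words *)

(* For [e < S_k], the [r] with [S_{r-1} <= e < S_r]: the piece number [e] of a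
   subdivided interval has relative length [b ^+ dtype e]. *)
Definition dtype (e : nat) : nat := (find (fun r => e < Lcum r.+1) (iota 0 k)).+1.

Lemma dtypeP (e : nat) : e < Lcum k ->
  [/\ 0 < dtype e <= k, Lcum (dtype e).-1 <= e & e < Lcum (dtype e)].
Proof.
move=> ek; rewrite /dtype; set a := fun r => _; set i := find a _.
have hasa : has a (iota 0 k).
  by apply/hasP; exists k.-1; rewrite ?mem_iota /a ?prednK //; lia.
have ik : i < k by move: hasa; rewrite has_find size_iota.
split=> //=.
  case iE : i => [|i']; first by rewrite /Lcum min0n /Lsum big_nil.
  have := before_find 0 (a := a) (s := iota 0 k) (i := i').
  by rewrite -/i iE nth_iota ?add0n ?ltnS ?leqnn /a; lia.
by have := nth_find 0 hasa; rewrite -/i nth_iota // add0n.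
Qed.

Lemma dtype0 : dtype 0 = 1.
Proof. by rewrite /dtype; case: (k) k_gt0 => //= k' _; rewrite Lcum_gt0. Qed.

Lemma dtype_leq (e j : nat) : e < Lcum j -> dtype e <= j.
Proof.
move=> ej; have ek := leq_trans ej (Lcum_leq_k j).
have [_ + _] := dtypeP ek; case: leqP => // jr.
move=> le; suff : Lcum j <= Lcum (dtype e).-1 by lia.
exact: leq_Lcum.
Qed.

(* The interval of the partition number [size w] with left endpoint [w] has
   length [b ^+ (size w + wtype w - 1)]. *)
Definition wtype (w : seq nat) : nat :=
  foldl (fun t e => if t == 1 then dtype e else t.-1) 1 w.

Lemma wtype_rcons (w : seq nat) (e : nat) :
  wtype (rcons w e) = if wtype w == 1 then dtype e else (wtype w).-1.
Proof. by rewrite /wtype foldl_rcons. Qed.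

Lemma wtype_words (m j : nat) (w : seq nat) :
  0 < j -> w \in words m j -> 0 < wtype w <= j.
Proof.
elim: m j w => [|m IHm] j w j0; first by rewrite inE => /eqP ->.
case/mem_words_rcons => [[v vW ->]|[v [e [vW ej ->]]]]; rewrite wtype_rcons.
  have := IHm _ _ (ltn0Sn _) vW; case: eqP => [_ _|]; first by rewrite dtype0.
  by lia.
have /eqP -> : wtype v == 1 by have := IHm _ _ (ltn0Sn _) vW; lia.
by rewrite eqxx dtype_leq //; lia.
Qed.

Lemma wtype_words1 (m : nat) (w : seq nat) : w \in words m 1 -> wtype w = 1.
Proof. by move=> /(wtype_words (ltn0Sn _)); lia. Qed.

(** Only intervals of maximal length, those of type 1, are subdivided; any other passes unchanged to
    the next partition, recorded by the digit 0. *)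
Lemma words_zero (M j p : nat) (v : seq nat) : 0 < j -> v \in words M j ->
  p < M -> wtype (take p v) != 1 -> nth 0 v p = 0.
Proof.
elim: M j v => // M IHM j v j0.
case/mem_words_rcons => [[w wW ->]|[w [e [wW ej ->]]]];
  rewrite ltnS leq_eqVlt => /orP[/eqP -> |pM].
- by rewrite nth_rcons (words_size wW) ltnn eqxx.
- rewrite take_rcons_le ?(words_size wW) 1?ltnW // => t1.
  by rewrite nth_rcons (words_size wW) pM (IHM j.+1).
- rewrite take_rcons_le ?(words_size wW) // -{1}(words_size wW) take_size.
  by rewrite (wtype_words1 wW).
- rewrite take_rcons_le ?(words_size wW) 1?ltnW // => t1.
  by rewrite nth_rcons (words_size wW) pM (IHM 1).
Qed.

Lemma words_digit (M j p : nat) (v : seq nat) :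
  v \in words M j -> p < M -> nth 0 v p < Lcum k.
Proof.
elim: M j v => // M IHM j v vW.
have [w [e [j' [wW vE ek]]]] : exists w e j',
    [/\ w \in words M j', v = rcons w e & e < Lcum k].
  case/mem_words_rcons: vW => [[w wW ->]|[w [e [wW ej ->]]]].
    by exists w, 0, j.+1; rewrite Lcum_gt0.
  exists w, e, 1; split => //.
  by case/andP: ej => _ /leq_trans; apply; exact: Lcum_leq_k.
rewrite vE ltnS leq_eqVlt nth_rcons (words_size wW) => /orP[/eqP ->|pM].
  by rewrite ltnn eqxx.
by rewrite pM; exact: IHM wW pM.
Qed.

(** For [w] of type 1, the zeros let piece number [e] wait until it has type 1 itself, at depth
    [size w + dtype e]. *)
Definition extension (w : seq nat) (e : nat) : seq nat :=
  rcons w e ++ nseq (dtype e).-1 0.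

Lemma cat_nseq0_words (m j : nat) (u : seq nat) :
  u \in words m j.+1 -> u ++ nseq j 0 \in words (m + j) 1.
Proof.
elim: j m u => [|j IHj] m u; first by rewrite cats0 addn0.
by move=> /rcons0_words /IHj; rewrite cat_rcons addSnnS.
Qed.

Lemma extension_words (m e : nat) (w : seq nat) :
  w \in words m 1 -> e < Lcum k -> extension w e \in words (m + dtype e) 1.
Proof.
move=> wW ek; rewrite -[dtype e]/((dtype e).-1.+1) -addSnnS.
by apply: cat_nseq0_words; apply: rcons_words => //; have [] := dtypeP ek.
Qed.

(** A piece of type [r] is not cut during the next [r - 1] steps, so the digit [e] forces the zeros
    that follow it. *)
Lemma take_extension (Q m e : nat) (v w : seq nat) :
    v \in words Q k -> w \in words m 1 -> e < Lcum k -> m + dtype e <= Q ->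
  (take (m + dtype e) v == extension w e) = (take m v == w) && (nth 0 v m == e).
Proof.
move=> vW wW ek leQ; have sw := words_size wW; have sv := words_size vW.
have e0 : 0 < dtype e by [].
apply/eqP/andP => [tE|[/eqP tE /eqP nE]].
  have mE : m < m + dtype e by lia.
  rewrite -(nth_take 0 mE) -(take_takel v (ltnW mE)) tE /extension.
  by rewrite cat_rcons nth_cat sw ltnn subnn take_size_cat.
(* Tracking the type as well, which drops by one per zero, keeps [words_zero] applicable. *)
suff gen t : t < dtype e ->
    take (m.+1 + t) v = rcons w e ++ nseq t 0
    /\ wtype (take (m.+1 + t) v) = dtype e - t.
  by have := (gen (dtype e).-1 (leqnn _)).1; rewrite addSnnS.
have takeS p : p < Q -> take p.+1 v = rcons (take p v) (nth 0 v p).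
  by move=> pQ; rewrite (take_nth 0) ?sv.
elim: t => [|t IHt] te.
  rewrite addn0 takeS; last lia.
  by rewrite tE nE cats0 subn0 wtype_rcons (wtype_words1 wW).
have [tE' tyE] := IHt (ltnW te).
rewrite addnS takeS; last lia.
have t1 : wtype (take (m.+1 + t) v) != 1 by rewrite tyE; lia.
rewrite (words_zero k_gt0 vW _ t1); last lia.
rewrite wtype_rcons (negPf t1) tyE tE'; split; last lia.
by rewrite rcons_cat; congr (_ ++ _); elim: (t) => //= t' ->.
Qed.

(** * Values of words as left endpoints *)

Local Open Scope ring_scope.
Variables (R : realType) (b : R).
Hypothesis b_gt0 : 0 < b.
Hypothesis b_root : \sum_(1 <= r < k.+1) (L r)%:R * b ^+ r = 1.

(** Total length of the first [e] pieces of an interval of length [b ^+ i]: the difference of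
    truncations counts those of relative length [b ^+ r]. *)
Definition offset (i e : nat) : R :=
  \sum_(1 <= r < k.+1) b ^+ (i + r) * ((e - Lsum L r.-1)%:R - (e - Lsum L r)%:R).

Lemma offset0 (i : nat) : offset i 0 = 0.
Proof. by apply: big1 => r _; rewrite !sub0n subrr mulr0. Qed.

Lemma offsetS (i e : nat) : (e < Lcum k)%N ->
  offset i e.+1 = offset i e + b ^+ (i + dtype e).
Proof.
move=> ek; have [/andP[r0 rk] le lt] := dtypeP ek.
have natSB s : (e.+1 - s)%:R = (e - s)%:R + (s <= e)%:R :> R.
  case: leqP => se; first by rewrite subSn // natr1.
  by rewrite addr0; congr _%:R; lia.
(* The two indicators differ only if [S_{r-1} <= e < S_r]. *)
have rE r : (1 <= r < k.+1)%N ->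
    (Lsum L r.-1 <= e)%:R - (Lsum L r <= e)%:R = (r == dtype e)%:R :> R.
  move=> /andP[r1]; rewrite ltnS => rk'.
  have -> : Lsum L r = Lcum r by rewrite /Lcum (minn_idPl rk').
  have -> : Lsum L r.-1 = Lcum r.-1.
    by rewrite /Lcum (minn_idPl (leq_trans (leq_pred r) rk')).
  have [rlt|rgt|->] := ltngtP r (dtype e).
  - have ler : (Lcum r <= e)%N by apply: leq_trans le; apply: leq_Lcum; lia.
    by rewrite ler (leq_trans _ ler) ?subrr // leq_Lcum ?leq_pred.
  - have gtr : (e < Lcum r.-1)%N by apply: leq_trans lt _; apply: leq_Lcum; lia.
    rewrite leqNgt gtr leqNgt (leq_trans gtr) ?subrr // leq_Lcum ?leq_pred //.
  - by rewrite le leqNgt lt subr0.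
have -> : b ^+ (i + dtype e) =
    \sum_(1 <= r < k.+1) (if r == dtype e then b ^+ (i + r) else 0).
  by rewrite -big_mkcond big_nat1_eq r0 ltnS rk.
rewrite /offset -big_split /=; apply: eq_big_nat => r rk'.
rewrite !natSB opprD addrACA rE // mulrDr; congr (_ + _).
by case: eqP => _; rewrite ?mulr1 ?mulr0.
Qed.

Lemma offset_sum (i e : nat) : (e <= Lcum k)%N ->
  offset i e = \sum_(0 <= e' < e) b ^+ (i + dtype e').
Proof.
elim: e => [|e IHe] ek; first by rewrite offset0 big_nil.
by rewrite offsetS // big_nat_recr //= IHe // ltnW.
Qed.

Lemma offset_le (i e e' : nat) : (e <= e' <= Lcum k)%N -> offset i e <= offset i e'.
Proof.
move=> /andP[ee' ek]; rewrite !offset_sum ?(leq_trans ee') //.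
rewrite [leRHS](@big_cat_nat _ _ _ e) //= lerDl.
by apply: sumr_ge0 => r _; rewrite exprn_ge0 // ltW.
Qed.

Lemma offset_full (i : nat) : offset i (Lcum k) = b ^+ i.
Proof.
rewrite -[RHS]mulr1 -b_root mulr_sumr; apply: eq_big_nat => r /andP[r1 rk].
rewrite exprD -mulrA; congr (_ * _); rewrite mulrC; congr (_ * _).
rewrite /Lcum minnn -natrB ?leq_sub2l ?leq_Lsum ?leq_pred //; congr _%:R.
have rk' : (Lsum L r <= Lsum L k)%N by exact: leq_Lsum.
by have := LsumS r.-1; rewrite prednK //; lia.
Qed.

Definition word_val (v : seq nat) : R :=
  \sum_(0 <= i < size v) offset i (nth 0%N v i).

Lemma word_val_rcons (v : seq nat) (e : nat) :
  word_val (rcons v e) = word_val v + offset (size v) e.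
Proof.
rewrite /word_val size_rcons big_nat_recr //= nth_rcons ltnn eqxx; congr (_ + _).
by apply: eq_big_nat => i /andP[_ iv]; rewrite nth_rcons iv.
Qed.

Lemma word_val_zeros (v : seq nat) (d : nat) : word_val (v ++ nseq d 0%N) = word_val v.
Proof.
elim: d v => [|d IHd] v; first by rewrite cats0.
by rewrite -cat_rcons IHd word_val_rcons offset0 addr0.
Qed.

Lemma word_val_extension (w : seq nat) (e : nat) :
  word_val (extension w e) = word_val w + offset (size w) e.
Proof. by rewrite word_val_zeros word_val_rcons. Qed.

(* Intervals of successive partitions are nested. *)
Lemma word_val_take (M j m : nat) (v : seq nat) :
    (0 < j)%N -> v \in words M j -> (m <= M)%N ->
  word_val (take m v) <= word_val v /\
  word_val v + b ^+ (M + (wtype v).-1)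
    <= word_val (take m v) + b ^+ (m + (wtype (take m v)).-1).
Proof.
elim: M j v => [|M IHM] j v j0 vW.
  by rewrite leqn0 => /eqP ->; rewrite -(words_size vW) take_size.
rewrite leq_eqVlt => /orP[/eqP ->|mM]; first by rewrite -(words_size vW) take_size.
have [w [e [j' [j'0 wW vE ek]]]] : exists w e j',
    [/\ (0 < j')%N, w \in words M j', v = rcons w e &
        (if wtype w == 1%N then e < Lcum k else e == 0)%N].
  case/mem_words_rcons: vW => [[w wW ->]|[w [e [wW ej ->]]]].
    by exists w, 0%N, j.+1; split=> //; rewrite eqxx Lcum_gt0 //; case: ifP.
  exists w, e, 1%N; split => //; rewrite (wtype_words1 wW) /=.
  by case/andP: ej => _ /leq_trans; apply; exact: Lcum_leq_k.
have sw := words_size wW.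
have [le1 le2] := IHM _ _ j'0 wW mM.
rewrite vE take_rcons_le ?sw // word_val_rcons wtype_rcons sw.
case: ifP ek => w1 ek.
  have e0 : 0 <= offset M e by rewrite -[leLHS](offset0 M) offset_le //= ltnW.
  split; first by rewrite -[leLHS]addr0 lerD.
  apply: le_trans le2; rewrite (eqP w1) addn0 -addrA lerD2l addSnnS prednK //.
  by rewrite -offsetS // -offset_full offset_le // ek leqnn.
rewrite (eqP ek) offset0 addr0; split=> //; apply: le_trans le2.
have /andP[w0 _] := wtype_words j'0 wW.
by rewrite (_ : (M.+1 + (wtype w).-1.-1 = M + (wtype w).-1)%N) //; lia.
Qed.

Lemma word_val_digit (Q m : nat) (v w : seq nat) (d := nth 0%N v m) :
    v \in words Q k -> w \in words m 1 -> (m < Q)%N -> take m v = w ->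
  [/\ (d < Lcum k)%N, word_val w + offset m d <= word_val v
    & word_val v < word_val w + offset m d.+1].
Proof.
move=> vW wW mQ tE; have sw := words_size wW.
have tSE : take m.+1 v = rcons w d.
  by rewrite (take_nth 0%N) ?(words_size vW) // tE.
have [le1 le2] := word_val_take k_gt0 vW mQ.
have dk : (d < Lcum k)%N by exact: words_digit vW mQ.
split=> //.
  by move: le1; rewrite tSE word_val_rcons sw.
rewrite offsetS // addrA.
(* Strictness comes from the positive length of the interval starting at [word_val v]. *)
apply: lt_le_trans (_ : word_val v + b ^+ (Q + (wtype v).-1) <= _).
  by rewrite ltrDl exprn_gt0.
move: le2; rewrite tSE word_val_rcons sw wtype_rcons (wtype_words1 wW) /=.
by rewrite addSnnS.
Qed.

(** Every partition fine enough to contain the index gives the same value, as trailing zeros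
    contribute nothing. *)
Lemma LSpointE (Q N : nat) : (1 < Lsum L k)%N -> (0 < N < tnum k L Q)%N ->
  LSpoint k L b N = word_val (nth [::] (words Q k) N).
Proof.
move=> S_gt1 /andP[N_gt0 ltN]; have /andP[leN ltN'] := level_spec S_gt1 N_gt0.
have nQ : (level k L N < Q)%N.
  rewrite ltnNge; apply/negP => /subnKC nE.
  by have := leq_tnumD Q (level k L N - Q); rewrite nE; lia.
rewrite -(subnKC nQ) nth_words_pad // word_val_zeros nth_words_digit //.
rewrite /word_val size_map size_iota; apply: eq_big_nat => i /andP[_ ilt].
by rewrite (nth_map 0%N) ?size_iota // nth_iota.
Qed.

Lemma word_val_nth0 (Q : nat) : word_val (nth [::] (words Q k) 0) = 0.
Proof.
by rewrite -[Q]add0n nth_words_pad ?tnum0 // word_val_zeros /word_val big_nil.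
Qed.

(** Both inequalities are weak because [y] may be the right endpoint [b ^+ i]. *)
Lemma offset_locate (i : nat) (y : R) : 0 <= y <= b ^+ i ->
  exists e, [/\ (e < Lcum k)%N, offset i e <= y & y <= offset i e.+1].
Proof.
move=> /andP[y0]; rewrite -offset_full.
suff gen s : (0 < s <= Lcum k)%N -> y <= offset i s ->
    exists e, [/\ (e < Lcum k)%N, offset i e <= y & y <= offset i e.+1].
  by apply: gen; rewrite leqnn Lcum_gt0.
elim: s => // s IHs /andP[_ sk] ys.
have [ys'|ys'] := leP (offset i s) y; first by exists s.
case: s => [|s] in IHs sk ys ys' *; first by move: ys'; rewrite offset0 ltNge y0.
by apply: IHs; rewrite ?(ltnW sk) // ltW.
Qed.

(** * Greedy cutting of an initial interval *)

Section Greedy.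
Variables (n : nat) (P : seq (seq nat)) (X E C : R).
(** Cutting stops once the depth exceeds [n]; a cut descends at most [k] levels, so the depth stays
    within [n + k]. *)
Local Notation Q := (n + k)%N.
Hypotheses (b_le1 : b <= 1) (S_gt1 : (1 < Lsum L k)%N).
Hypotheses (PQ : {subset P <= words Q k}) (X_ge0 : 0 <= X) (E_ge0 : 0 <= E).
Hypothesis (XC : X * b ^+ n.+1 <= C).
Hypothesis prefix_bound : forall p u, u \in words p 1 -> (p <= Q)%N ->
  `|(count (fun v => take p v == u) P)%:R - X * b ^+ p| <= E.
Local Notation F := ((L 1 + Lsum L k - 2)%:R : R).

(** Pieces before number [e] lie wholly to the left of [x], later ones contain no point below [x];
    only piece [e] is split further. *)
Lemma count_below_split (m e : nat) (w : seq nat) (x : R) :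
    w \in words m 1 -> (m <= n)%N -> (e < Lcum k)%N ->
    word_val w + offset m e <= x -> x <= word_val w + offset m e.+1 ->
  count (fun v => (take m v == w) && (word_val v < x)) P =
  (\sum_(0 <= e' < e) count (fun v => take (m + dtype e') v == extension w e') P
   + count (fun v => (take (m + dtype e) v == extension w e)
                     && (word_val v < x)%R) P)%N.
Proof.
move=> wW mn ek lex xle; have mQ : (m < Q)%N.
  by rewrite (leq_ltn_trans mn) // -[ltnLHS]addn0 ltn_add2l.
have dQ e' : (e' < Lcum k)%N -> (m + dtype e' <= Q)%N.
  by move=> e'k; have [/andP[_ re'] _ _] := dtypeP e'k; exact: leq_add.
elim: P PQ => [|v s IHs] sub /=; first by rewrite big1.
have vW : v \in words Q k by apply: sub; rewrite mem_head.
rewrite big_split /= addnACA -IHs; last by move=> u us; apply: sub; rewrite inE us orbT.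
congr (_ + _)%N; rewrite (take_extension vW wW ek (dQ e ek)).
have -> : (\sum_(0 <= e' < e) (take (m + dtype e') v == extension w e') =
    ((take m v == w) && (nth 0 v m < e)))%N.
  transitivity (\sum_(0 <= e' < e | e' == nth 0 v m) (take m v == w))%N.
    rewrite [RHS]big_mkcond; apply: eq_big_nat => e' /andP[_ e'e].
    have e'k := ltn_trans e'e ek.
    rewrite (take_extension vW wW e'k (dQ e' e'k)) eq_sym [_ == e']eq_sym.
    by rewrite [w == _]eq_sym; case: (e' == _); rewrite ?andbT ?andbF.
  by rewrite big_nat1_eq /=; case: (_ < e)%N; rewrite ?andbT ?andbF.
case: eqP => //= tE; have [dk le1 lt1] := word_val_digit vW wW mQ tE.
have [de|ed|de] := ltngtP (nth 0%N v m) e.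
- rewrite /= addn0 (lt_le_trans lt1) // (le_trans _ lex) // lerD2l offset_le //.
  by rewrite de ltnW.
- rewrite ltNge (le_trans xle) // (le_trans _ le1) // lerD2l offset_le //.
  by rewrite ed ltnW.
- by rewrite add0n.
Qed.

(** For type 1, [e <= L_1 - 1] and [L_1 <= S_k]. For type at least 2, [e <= S_k - 1 <= F] because
    [L_1 >= 1]. *)
Lemma digit_leq_half (e : nat) : (e < Lcum k)%N -> e%:R <= (dtype e)%:R * (F / 2).
Proof.
move=> ek; have [/andP[r0 rk] _ er] := dtypeP ek.
rewrite mulrA ler_pdivlMr // -!natrM ler_nat.
have S1 : Lcum 1 = L 1 by rewrite /Lcum (minn_idPl k_gt0) /Lsum big_nat1.
have Lk : Lcum k = Lsum L k by rewrite /Lcum minnn.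
have rk' := Lcum_leq_k (dtype e).
have [r1|r1] := eqVneq (dtype e) 1%N.
  by move: er rk'; rewrite r1 S1 Lk; lia.
have r2 : (2 <= dtype e)%N by lia.
move: er rk' ek S_gt1 L1_gt0; rewrite Lk.
by move: r2 {r0 rk S1 Lk r1}; generalize (Lcum (dtype e)) (dtype e) (Lsum L k) (L 1); nia.
Qed.

Lemma leftover_bound (m : nat) (w : seq nat) (x : R) :
    w \in words m 1 -> (m <= Q)%N -> word_val w <= x <= word_val w + b ^+ m ->
    (n < m)%N ->
  `|(count (fun v => (take m v == w) && (word_val v < x)) P)%:R
     - X * (x - word_val w)| <= (Q - m)%:R * (F / 2) * E + (E + C).
Proof.
move=> wW mQ /andP[wx xw] nm; apply: (@le_trans _ _ (E + C)); last first.
  by rewrite lerDr !mulr_ge0 ?invr_ge0 ?ler0n.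
have Xb : X * b ^+ m <= C.
  apply: le_trans XC; rewrite ler_wpM2l // ler_wiXn2l // ltW //.
apply: ler_norm_sub_part (prefix_bound wW mQ) _ _ Xb => //.
  by rewrite ler0n ler_nat; apply: sub_count => v /andP[].
by rewrite mulr_ge0 ?subr_ge0 // ler_wpM2l // lerBlDl.
Qed.

Lemma prefix_below_bound (m : nat) (w : seq nat) (x : R) :
    w \in words m 1 -> (m <= Q)%N -> word_val w <= x <= word_val w + b ^+ m ->
  `|(count (fun v => (take m v == w) && (word_val v < x)) P)%:R
     - X * (x - word_val w)| <= (Q - m)%:R * (F / 2) * E + (E + C).
Proof.
have F_ge0 : 0 <= F / 2 by rewrite divr_ge0 ?ler0n.
(* [d] only bounds [Q - m], as a cut may advance [m] by more than 1. *)
move: {2}(Q - m)%N (leqnn (Q - m)) => d.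
elim: d m w x => [|d IHd] m w x Qm wW mQ /andP[wx xw];
  have [mn|nm] := leqP m n; try exact/leftover_bound/nm/andP.
  have : (Q <= n)%N by rewrite (leq_trans _ mn) // -subn_eq0 -leqn0.
  by rewrite -[leqRHS]addn0 leq_add2l leqNgt k_gt0.
have [e [ek le1 le2]] : exists e, [/\ (e < Lcum k)%N,
    offset m e <= x - word_val w & x - word_val w <= offset m e.+1].
  by apply: offset_locate; rewrite subr_ge0 wx lerBlDl.
rewrite lerBrDl in le1; rewrite lerBlDl in le2.
have [/andP[r0 rk] _ _] := dtypeP ek.
rewrite (@count_below_split m e) //.
have eW := extension_words wW ek.
have rQ : (m + dtype e <= Q)%N by exact: leq_add.
have eV := word_val_extension w e; rewrite (words_size wW) in eV.
have := IHd (m + dtype e)%N (extension w e) x _ eW rQ.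
rewrite eV le1 -addrA -offsetS // le2 => /(_ _ isT).
have -> : (Q - (m + dtype e) <= d)%N.
  by rewrite subnDA leq_subLR (leq_trans Qm) // -add1n leq_add2r.
move=> /(_ isT); set c := count _ P => IH.
(* The lengths of the first [e] pieces add up to [offset m e], so the error splits into one term per
   full piece and one for the cut piece. *)
have -> : (\sum_(0 <= e' < e) count (fun v => take (m + dtype e') v == extension w e') P + c)%:R
    - X * (x - word_val w) =
    \sum_(0 <= e' < e) ((count (fun v => take (m + dtype e') v == extension w e') P)%:R
       - X * b ^+ (m + dtype e')) + (c%:R - X * (x - (word_val w + offset m e))).
  rewrite natrD natr_sum sumrB -mulr_sumr -offset_sum; last exact: ltnW.
  by ring.
apply: le_trans (ler_normD _ _) _.
have sumE : `|\sum_(0 <= e' < e) ((count (fun v => take (m + dtype e') v == extension w e') P)%:R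
       - X * b ^+ (m + dtype e'))| <= e%:R * E.
  apply: le_trans (ler_norm_sum _ _ _) _.
  rewrite mulr_natl -[X in _ *+ X](subn0 e) -sumr_const_nat.
  apply: ler_sum_nat => e' /andP[_ e'e]; have e'k := ltn_trans e'e ek.
  apply: prefix_bound; first exact: extension_words.
  by have [/andP[_ re'] _ _] := dtypeP e'k; exact: leq_add.
apply: le_trans (lerD sumE IH) _.
rewrite addrA lerD2r -mulrDl ler_wpM2r //.
have -> : (Q - m = dtype e + (Q - (m + dtype e)))%N.
  by rewrite subnDA subnKC // leq_subRL.
by rewrite natrD mulrDl lerD2r digit_leq_half.
Qed.

End Greedy.

(** * Expansion in powers of the roots *)

Section Remainder.
Variables (beta : nat -> R[i]) (lambda : nat -> nat -> R[i]).
Hypotheses (b_lt1 : b < 1) (S_gt1 : (1 < Lsum L k)%N).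
Hypothesis beta1 : beta 1%N = (b%:C)%C.
Hypothesis beta_gt1 : forall j, (2 <= j <= k)%N -> 1 < cmod (beta j).
Hypothesis lambdaP : forall n i, (i <= k)%N ->
  (lnum k L n i)%:R = \sum_(1 <= j < k.+1) lambda j i * beta j ^- n.

Local Notation rho j := ((cmod (beta j))^-1).

Lemma cmod_real (x : R) : cmod (x%:C)%C = `|x|.
Proof. by rewrite /= expr0n /= addr0 sqrtr_sqr. Qed.

Lemma cmod_ge0 (z : R[i]) : 0 <= cmod z.
Proof. by case: z => x y; exact: sqrtr_ge0. Qed.

Lemma cmodX (z : R[i]) (n : nat) : cmod (z ^+ n) = cmod z ^+ n.
Proof.
elim: n => [|n IHn]; first by rewrite !expr0 ComplexField.Normc.normc1.
by rewrite !exprS ComplexField.Normc.normcM IHn.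
Qed.

Lemma cmod_sum (I : Type) (r : seq I) (Pr : pred I) (f : I -> R[i]) :
  cmod (\sum_(i <- r | Pr i) f i) <= \sum_(i <- r | Pr i) cmod (f i).
Proof.
apply: (big_ind2 (fun x y => cmod x <= y)) => // [|x1 x2 y1 y2 h1 h2].
  by rewrite ComplexField.Normc.normc0.
exact: le_trans (le_normcD _ _) (lerD h1 h2).
Qed.

Lemma rho_itv (j : nat) : (2 <= j <= k)%N -> 0 < rho j < 1.
Proof.
move=> /beta_gt1 h; have h0 := lt_trans ltr01 h.
by rewrite invr_gt0 h0 invf_lt1.
Qed.

(** The cap at [k] keeps [l] in the range where [lambdaP] holds. *)
Lemma lcum_lambda (m j : nat) : (lcum m j)%:R =
  \sum_(1 <= i < k.+1) (\sum_(1 <= l < (minn j k).+1) lambda i l) * beta i ^- m.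
Proof.
under eq_bigr do rewrite mulr_suml.
rewrite exchange_big /= -lcum_minn /lcum natr_sum.
apply: eq_big_nat => -[|l] // /andP[_]; rewrite ltnS => lk.
by rewrite -lambdaP //; exact: leq_trans lk (geq_minr j k).
Qed.

(* The contribution of [beta 1 = b] cancels exactly. *)
Lemma lcum_scaling (p d j : nat) :
  `|(lcum d j)%:R - (lcum (p + d) j)%:R * b ^+ p| <=
  \sum_(2 <= i < k.+1)
    2 * (\sum_(1 <= l < (minn j k).+1) cmod (lambda i l)) * rho i ^+ d.
Proof.
have bC : (b%:C)%C != 0 by rewrite fmorph_eq0 gt_eqF.
rewrite -cmod_real rmorphB rmorphM rmorphXn /= !rmorph_nat !lcum_lambda.
rewrite mulr_suml -sumrB.
under [X in cmod X]eq_bigr do rewrite -mulrA -mulrBr.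
rewrite big_ltn //= beta1 exprD invfM mulrAC mulVf ?expf_neq0 // mul1r subrr.
rewrite mulr0 add0r; apply: le_trans (cmod_sum _ _ _) _.
apply: ler_sum_nat => i ik; have /andP[r0 r1] := rho_itv ik.
rewrite ComplexField.Normc.normcM mulrAC mulrC.
rewrite ler_pM ?cmod_ge0 //; last exact: cmod_sum.
apply: le_trans (le_normcD _ _) _; rewrite normcN.
rewrite ComplexField.Normc.normcM !ComplexField.Normc.normcV !cmodX cmod_real.
rewrite gtr0_norm // -!exprVn mulrDl mul1r lerD2l exprD mulrAC.
by rewrite ler_piMl ?exprn_ge0 ?mulr_ile1 ?exprn_ge0 ?exprn_ile1 // ltW.
Qed.

Definition lambda0_sum : R :=
  cmod (lambda 1 0) + \sum_(2 <= i < k.+1) cmod (lambda i 0%N).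

(** The factor [b ^+ p] turns the term of [beta 1] into the constant [lambda 1 0] and shrinks all
    others. *)
Lemma tnum_scaled_le (p : nat) : (tnum k L p)%:R * b ^+ p <= lambda0_sum.
Proof.
have bC : (b%:C)%C != 0 by rewrite fmorph_eq0 gt_eqF.
apply: le_trans (ler_norm _) _.
rewrite -cmod_real rmorphM rmorphXn /= rmorph_nat.
rewrite -[tnum k L p]/(lnum k L p 0) lambdaP // mulr_suml.
under eq_bigr do rewrite -mulrA.
rewrite big_ltn //= beta1 mulVf ?expf_neq0 // mulr1.
apply: le_trans (le_normcD _ _) _; rewrite lerD2l.
apply: le_trans (cmod_sum _ _ _) _.
apply: ler_sum_nat => i ik; have /andP[r0 r1] := rho_itv ik.
rewrite !ComplexField.Normc.normcM ComplexField.Normc.normcV !cmodX cmod_real.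
rewrite gtr0_norm // -!exprVn ler_piMr ?cmod_ge0 //.
by rewrite mulr_ile1 ?exprn_ge0 ?exprn_ile1 // ltW.
Qed.

Lemma lambda0_sum_ge1 : 1 <= lambda0_sum.
Proof. by have := tnum_scaled_le 0; rewrite tnum0 expr0 mulr1. Qed.

Lemma Lambda_numerator_le (j l : nat) : (2 <= j <= k)%N -> (2 <= l <= k)%N ->
  \sum_(1 <= i < l.+1) cmod (lambda j i) + ((Lsum L k)%:R - 2) * cmod (lambda j 1%N)
  <= Lambda k L beta lambda j * (1 - rho j).
Proof.
move=> jk lk; have /andP[r0 r1] := rho_itv jk.
rewrite -ler_pdivrMr ?subr_gt0 //.
rewrite -[leLHS]/(Lambda_term k L beta lambda j l).
by apply: Order.TotalTheory.le_bigmax_seq; rewrite // mem_index_iota.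
Qed.

Lemma Lambda_ge0 (j : nat) : (2 <= j <= k)%N -> 0 <= Lambda k L beta lambda j.
Proof.
move=> jk; have /andP[r0 r1] := rho_itv jk.
rewrite -(pmulr_lge0 _ (_ : 0 < 1 - rho j)) ?subr_gt0 //.
apply: le_trans (Lambda_numerator_le jk (_ : 2 <= 2 <= k)%N); last by lia.
rewrite addr_ge0 ?sumr_ge0 ?mulr_ge0 ?cmod_ge0 // => [i _|]; first exact: cmod_ge0.
by rewrite subr_ge0 ler_nat.
Qed.

(** * The counting error of one piece *)

(** Induction on the number [d] of digits above the prefix. Removing the highest of [d + 1] digits
    costs at most [2 * Lambda * (1 - rho) * rho ^+ d] per root other than [beta 1], exactly the
    increment of [2 * Lambda * (1 - rho ^+ d)]. *)
Lemma prefix_take_bound (p d j N : nat) (u : seq nat) :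
    (0 < j)%N -> u \in words p 1 -> (N < lcum (p + d) j)%N ->
  `|(count (fun v => take p v == u) (take N.+1 (words (p + d) j)))%:R
    - N.+1%:R * b ^+ p|
  <= lambda0_sum + \sum_(2 <= i < k.+1) 2 * Lambda k L beta lambda i * (1 - rho i ^+ d).
Proof.
move=> + uW; elim: d j N => [|d IHd] j N j0 ltN.
  (* With no digit above the prefix at most one word matches; this count and [N.+1 * b ^+ p] both
     lie between 0 and [lambda0_sum]. *)
  rewrite big_nat_cond big1 => [|i _]; last by rewrite expr0 subrr mulr0.
  rewrite addr0.
  have c1 : (count (fun v => take p v == u) (take N.+1 (words (p + 0) j)) <= 1)%N.
    have l01 : lcum 0 j = 1%N by rewrite -size_words.
    rewrite -[leqRHS]l01 -(count_prefix_words 0 j0 uW).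
    rewrite -[X in (_ <= count _ X)%N](cat_take_drop N.+1) count_cat.
    exact: leq_addr.
  rewrite addn0 in ltN *.
  have Nt : N.+1%:R * b ^+ p <= lambda0_sum.
    apply: le_trans (tnum_scaled_le p); rewrite ler_wpM2r ?exprn_ge0 ?(ltW b_gt0) //.
    by rewrite ler_nat (leq_trans ltN) // leq_lcum_tnum.
  have Nt0 : 0 <= N.+1%:R * b ^+ p by rewrite mulr_ge0 ?exprn_ge0 ?(ltW b_gt0) ?ler0n.
  rewrite addn0 in c1; apply: ler_norm_sub_itv; last exact/andP.
  by rewrite ler0n (le_trans _ lambda0_sum_ge1) // (ler_nat _ _ 1).
have rd i : (2 <= i <= k)%N -> 0 <= rho i ^+ d.
  by move=> /rho_itv/andP[r0 _]; rewrite exprn_ge0 ?ltW.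
rewrite addnS in ltN *; have [ltN'|geN] := ltnP N (lcum (p + d) j.+1).
  rewrite take_words_step // count_map.
  rewrite (eq_in_count (a2 := fun v => take p v == u)); last first.
    by move=> v /mem_take; apply: take_rcons_words; rewrite leq_addr.
  apply: le_trans (IHd j.+1 N isT ltN') _; rewrite lerD2l.
  apply: ler_sum_nat => i ik; have /andP[r0 r1] := rho_itv ik.
  rewrite ler_wpM2l ?mulr_ge0 ?Lambda_ge0 // lerD2l lerN2 exprS ler_piMl ?rd //.
  exact: ltW.
rewrite count_take_prefix_step ?geN //.
set M := (N - _)%N; set l := lpos _ _ _ _.
have l0 : (0 < l)%N by exact: lpos1_gt0.
set c := count _ _.
have NE : N.+1 = (lcum (p + d) j.+1 + M %/ l * l + (M %% l).+1)%N.
  by rewrite addnS -addnA -divn_eq subnKC.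
rewrite NE.
(* The highest digit is [eta + 1 <= S_j - 1]; this produces the factor [S_k - 2] in [Lambda]. *)
have eta_le : (M %/ l <= Lsum L k - 2)%N.
  have SS : (Lcum j <= Lsum L k)%N by have := Lcum_leq_k j; rewrite /Lcum minnn.
  have Ml : (M < (Lcum j - 1) * l)%N.
    move: (lcum_rec (p + d) j) (Lcum_gt0 j0) geN ltN; rewrite /M -/l mulnBl mul1n.
    by clear; lia.
  have : (M %/ l < Lcum j - 1)%N by rewrite ltn_divLR.
  by move: SS; clear; lia.
set eta := (M %/ l)%N in eta_le *.
(* Three errors: highest digit 0, the [eta] complete blocks, and the started block, which is left to
   the induction. *)
have -> : (lcum d j.+1 + eta * lpos k L d 1 + c)%:R
    - (lcum (p + d) j.+1 + eta * l + (M %% l).+1)%:R * b ^+ p =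
    ((lcum d j.+1)%:R - (lcum (p + d) j.+1)%:R * b ^+ p)
    + eta%:R * ((lcum d 1)%:R - (lcum (p + d) 1)%:R * b ^+ p)
    + (c%:R - (M %% l).+1%:R * b ^+ p).
  by rewrite !lcum1 -/l !natrD !natrM; ring.
have ltM : (M %% l < lcum (p + d) 1)%N by rewrite lcum1 ltn_pmod.
have IH := IHd 1%N _ isT ltM; rewrite -/c in IH.
apply: le_trans (ler_normD _ _) _.
apply: le_trans (lerD (ler_normD _ _) IH) _.
rewrite normrM ger0_norm ?ler0n //.
apply: le_trans (lerD (lerD (lcum_scaling p d j.+1)
  (ler_wpM2l (ler0n _ _) (lcum_scaling p d 1))) (lexx _)) _.
rewrite [leLHS]addrCA lerD2l mulr_sumr -!big_split /=.
apply: ler_sum_nat => i ik.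
have /andP[i2 ik'] : (2 <= i <= k)%N := ik.
(* This number of types is an admissible index in the maximum [Lambda]; a root number [i >= 2]
   entails [k >= 2]. *)
have lk : (2 <= minn j.+1 k <= k)%N.
  by rewrite geq_minr leq_min ltnS j0 (leq_trans i2).
have k1 : minn 1 k = 1%N by apply/minn_idPl.
rewrite k1 big_nat1.
have := Lambda_numerator_le ik lk.
set A := \sum_(1 <= l0 < _) _; set a := cmod (lambda i 1) => numer.
have etaS : eta%:R * a <= ((Lsum L k)%:R - 2) * a.
  by rewrite ler_wpM2r ?cmod_ge0 // -natrB // ler_nat.
have le2 : (A + eta%:R * a) * rho i ^+ d
    <= Lambda k L beta lambda i * (1 - rho i) * rho i ^+ d.
  by rewrite ler_wpM2r ?rd // (le_trans _ numer) // lerD2l.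
have -> : 2 * A * rho i ^+ d + eta%:R * (2 * a * rho i ^+ d)
    = 2 * ((A + eta%:R * a) * rho i ^+ d) by ring.
have -> : 2 * Lambda k L beta lambda i * (1 - rho i ^+ d.+1)
    = 2 * (Lambda k L beta lambda i * (1 - rho i) * rho i ^+ d)
      + 2 * Lambda k L beta lambda i * (1 - rho i ^+ d) by rewrite exprS; ring.
by rewrite lerD2r ler_pM2l.
Qed.

(** The previous bound made uniform in [d]; it serves as [E] in the greedy cutting. *)
Definition piece_error : R :=
  lambda0_sum + \sum_(2 <= i < k.+1) 2 * Lambda k L beta lambda i.

Lemma Rtilde_piece_error : Rtilde k L beta lambda = 1 + piece_error.
Proof. by rewrite /Rtilde /piece_error /lambda0_sum big_split /=; ring. Qed.

Lemma piece_error_ge0 : 0 <= piece_error.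
Proof.
rewrite addr_ge0 ?(le_trans ler01 lambda0_sum_ge1) // big_nat_cond sumr_ge0 //.
by move=> i; rewrite andbT ltnS => ik; rewrite mulr_ge0 ?Lambda_ge0.
Qed.

Lemma prefix_take_piece_error (p Q N : nat) (u : seq nat) :
    u \in words p 1 -> (p <= Q)%N -> (N < tnum k L Q)%N ->
  `|(count (fun v => take p v == u) (take N.+1 (words Q k)))%:R - N.+1%:R * b ^+ p|
  <= piece_error.
Proof.
move=> uW pQ; rewrite -(lcum_geq_k Q (leqnn k)) -(subnKC pQ) => ltN.
apply: le_trans (prefix_take_bound k_gt0 uW ltN) _; rewrite lerD2l.
apply: ler_sum_nat => i ik; have /andP[r0 r1] := rho_itv ik.
rewrite ler_piMr ?mulr_ge0 ?Lambda_ge0 // gerBl exprn_ge0 // ltW //.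
Qed.

(** * Counting points in an initial interval *)

Lemma count_below_bound (n N : nat) (x : R) :
    (N < tnum k L n.+1)%N -> 0 <= x <= 1 ->
  `|(count (fun v => word_val v < x)%R (take N.+1 (words (n + k) k)))%:R - N.+1%:R * x|
  <= (n + k)%:R * ((L 1 + Lsum L k - 2)%:R / 2) * piece_error
     + (piece_error + lambda0_sum).
Proof.
move=> ltN x01.
have ltNQ : (N < tnum k L (n + k))%N.
  have -> : (n + k = n.+1 + k.-1)%N by rewrite addSnnS prednK.
  exact: leq_trans ltN (leq_tnumD _ _).
have XC : N.+1%:R * b ^+ n.+1 <= lambda0_sum.
  apply: le_trans (tnum_scaled_le n.+1).
  by rewrite ler_wpM2r ?exprn_ge0 ?(ltW b_gt0) // ler_nat.
have PQ : {subset take N.+1 (words (n + k) k) <= words (n + k) k}.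
  by move=> v /mem_take.
have val0 : word_val [::] = 0 by rewrite /word_val big_nil.
(* The cutting starts from the empty word, that is from [[0, 1)]. *)
have := @prefix_below_bound n _ N.+1%:R piece_error lambda0_sum (ltW b_lt1) S_gt1
  PQ (ler0n _ _) piece_error_ge0 XC
  (fun p u uW pQ => prefix_take_piece_error uW pQ ltNQ) 0 [::] x isT isT.
rewrite val0 add0r expr0 subn0 subr0 => /(_ x01).
by under eq_count do rewrite take0 eqxx /=.
Qed.

(** * Logarithmic size of the level *)

(** The lengths in each partition add up to 1; the factor [b] turns the exponent [n + i - 1] into
    [n + i]. *)
Lemma lpos_total_length (n : nat) :
  \sum_(1 <= i < k.+1) (lpos k L n i)%:R * b ^+ (n + i) = b.
Proof.
elim: n => [|n IHn].
  rewrite big_ltn //= mul1r add0n big_nat_cond big1 ?addr0 ?expr1 //.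
  by case=> [|[|i]] //= _; rewrite mul0r.
transitivity (\sum_(1 <= i < k.+1) ((lpos k L n i.+1)%:R * b ^+ (n + i.+1)
    + (lpos k L n 1)%:R * b ^+ n.+1 * ((L i)%:R * b ^+ i))).
  apply: eq_big_nat => i; rewrite ltnS /= => ->; rewrite natrD natrM addSnnS.
  by rewrite !exprD !exprS; ring.
rewrite big_split /= -mulr_sumr b_root mulr1 -[RHS]IHn [RHS]big_ltn // addn1 [LHS]addrC.
congr (_ + _).
transitivity (\sum_(2 <= i < k.+2) (lpos k L n i)%:R * b ^+ (n + i)).
  by rewrite [RHS]big_add1.
by rewrite big_nat_recr //= lpos_gt_k // mul0r addr0.
Qed.

(** No interval of the partition number [n] is longer than [b ^+ n], and together they have length
    1. *)
Lemma tnum_scaled_ge1 (n : nat) : 1 <= (tnum k L n)%:R * b ^+ n.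
Proof.
rewrite -(ler_pM2r b_gt0) mul1r -[leLHS](lpos_total_length n) -mulrA -exprSr.
rewrite /tnum natr_sum mulr_suml; apply: ler_sum_nat => i /andP[i1 _].
by rewrite ler_wpM2l ?ler0n // ler_wiXn2l ?(ltW b_gt0) ?(ltW b_lt1) // -addn1 leq_add2l.
Qed.

Lemma level_ln_le (n N : nat) : (tnum k L n <= N)%N -> n%:R * `|ln b| <= ln N.+1%:R.
Proof.
move=> tN; have bn0 : 0 < b ^- n by rewrite invr_gt0 exprn_gt0.
rewrite ler0_norm; last by rewrite ln_le0 // ltW.
have -> : n%:R * - ln b = ln (b ^- n).
  by rewrite lnV ?posrE ?exprn_gt0 // lnXn // mulrN mulr_natl.
rewrite ler_ln ?posrE ?ltr0n //.
rewrite -[leLHS]mul1r ler_pdivrMr ?exprn_gt0 //.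
apply: le_trans (tnum_scaled_ge1 n) _.
by rewrite ler_wpM2r ?exprn_ge0 ?(ltW b_gt0) // ler_nat (leq_trans tN).
Qed.

(** * Local discrepancy *)

(** The word list starts with index 0, whose point is 0, while the sum starts with index 1; hence
    the correction. *)
Lemma sum_LSpoint_below (Q N : nat) (c : R) : (N < tnum k L Q)%N ->
  \sum_(1 <= i < N.+1) (LSpoint k L b i < c)%R%:R =
  (count (fun v => word_val v < c)%R (take N.+1 (words Q k)))%:R - (0 < c)%R%:R :> R.
Proof.
move=> ltN; have sz : size (words Q k) = tnum k L Q.
  by rewrite size_words // lcum_geq_k.
have -> : (count (fun v => word_val v < c)%R (take N.+1 (words Q k)))%:R
    = \sum_(0 <= i < N.+1) (word_val (nth [::] (words Q k) i) < c)%R%:R :> R.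
  rewrite -sum1_count natr_sum big_mkcond (big_nth [::]) size_takel ?sz //.
  apply: eq_big_nat => i /andP[_ iN]; rewrite nth_take //.
  by case: (_ < c).
rewrite [in RHS]big_ltn // word_val_nth0 [RHS]addrC addKr.
apply: eq_big_nat => i /andP[i1 iN].
by rewrite (@LSpointE Q) // i1 (leq_trans iN).
Qed.

Lemma local_discrepancy_bound (n N : nat) (a c : R) :
    (N < tnum k L n.+1)%N -> 0 <= a -> a < c -> c <= 1 ->
  `|\sum_(1 <= i < N.+1) (LSpoint k L b i \in `[a, c[)%:R - N%:R * (c - a)|
  <= (n + k)%:R * (L 1 + Lsum L k - 2)%:R * piece_error
     + 2 * (piece_error + lambda0_sum) + 1.
Proof.
move=> ltN a0 ac c1.
have ltNQ : (N < tnum k L (n + k))%N.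
  have -> : (n + k = n.+1 + k.-1)%N by rewrite addSnnS prednK.
  exact: leq_trans ltN (leq_tnumD _ _).
have -> : \sum_(1 <= i < N.+1) (LSpoint k L b i \in `[a, c[)%:R =
    \sum_(1 <= i < N.+1) ((LSpoint k L b i < c)%R%:R - (LSpoint k L b i < a)%R%:R) :> R.
  apply: eq_big_nat => i _; rewrite ?mem_setE in_itv /=.
  case: (ltP _ a) => [xa|xa]; last by rewrite /= subr0.
  by rewrite (lt_trans xa ac) /= subrr.
rewrite sumrB !(sum_LSpoint_below _ ltNQ).
have ca : 0 <= a <= 1 by rewrite a0 (le_trans (ltW ac)).
have cc : 0 <= c <= 1 by rewrite c1 (le_trans a0 (ltW ac)).
have := count_below_bound ltN ca; have := count_below_bound ltN cc.
rewrite (le_lt_trans a0 ac) -natr1 /=.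
move=> hc ha; apply: le_trans (local_discrepancy_combine hc ha a0 ac c1) _.
by rewrite le_eqVlt; apply/orP; left; apply/eqP; field.
Qed.

End Remainder.

End LSsequence.

(** * Consequences of the root condition, and the conclusion *)

Lemma LSpoly_root (R : realType) (k : nat) (L : nat -> nat) (b : R) :
  root (LSpoly R k L) (b%:C)%C -> \sum_(1 <= r < k.+1) (L r)%:R * b ^+ r = 1.
Proof.
move=> /rootP; rewrite /LSpoly hornerD hornerN hornerC horner_sum => /eqP.
rewrite subr_eq0 => /eqP sumE; apply: (fmorph_inj (real_complex R)).
rewrite rmorph1 -[RHS]sumE rmorph_sum /=; apply: eq_bigr => r _.
by rewrite rmorphM rmorphXn /= rmorph_nat hornerZ hornerXn.
Qed.

(** Otherwise the sum, which is 1, would be at most [S_k * b <= b < 1]. *)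
Lemma Lsum_gt1 (R : realType) (k : nat) (L : nat -> nat) (b : R) :
    0 < b < 1 -> \sum_(1 <= r < k.+1) (L r)%:R * b ^+ r = 1 ->
  (1 < Lsum L k)%N.
Proof.
move=> /andP[b0 b1] bE.
have le1 : 1 <= (Lsum L k)%:R * b.
  rewrite -[leLHS]bE /Lsum natr_sum mulr_suml; apply: ler_sum_nat => r /andP[r1 _].
  rewrite ler_wpM2l ?ler0n // -[leRHS]expr1 ler_wiXn2l // ltW //.
rewrite ltnNge; apply/negP => S1.
have : (Lsum L k)%:R * b <= b.
  by rewrite -[leRHS]mul1r ler_wpM2r ?(ltW b0) // (ler_nat _ _ 1).
by move=> /(le_trans le1) /le_lt_trans /(_ b1); rewrite ltxx.
Qed.

(* The factor [1 + E] instead of [E] gains [m] over [(m + k) * F * E], which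
   eventually absorbs every constant. *)
Lemma linear_absorb (R : realType) (m k F E K c M : R) :
    0 <= m -> 1 <= F -> 0 <= E -> m - c <= M ->
    k * F * E + K + `|c| * F * (1 + E) <= m ->
  (m + k) * F * E + K <= M * F * (1 + E).
Proof.
move=> m0 F1 E0 mM mK.
have F0 : 0 <= F by exact: le_trans ler01 F1.
have G0 : 0 <= F * (1 + E) by rewrite mulr_ge0 // addr_ge0.
have h1 : (m - `|c|) * (F * (1 + E)) <= M * (F * (1 + E)).
  rewrite ler_wpM2r // (le_trans _ mM) // lerD2l lerN2; exact: ler_norm.
have h2 : m <= m * F by rewrite ler_peMr.
rewrite -[leRHS]mulrA; apply: le_trans h1; lra.
Qed.

Theorem theorem2 (R : realType) (k : nat) (L : nat -> nat)
    (b : R) (beta : nat -> R[i]) (lambda : nat -> nat -> R[i])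
    (hk : (1 <= k)%N)
    (hL : (L 1 * L k != 0)%N)
    (hsimple : forall z : R[i], (mup z (LSpoly R k L) <= 1)%N)
    (hroots : forall z : R[i],
      root (LSpoly R k L) z <-> exists2 j, (1 <= j <= k)%N & z = beta j)
    (hbeta1 : beta 1%N = (b%:C)%C)
    (hb : 0 < b < 1)
    (hbeta : forall j, (2 <= j <= k)%N -> 1 < cmod (beta j))
    (hlambda : forall n i, (i <= k)%N ->
      (lnum k L n i)%:R = \sum_(1 <= j < k.+1) lambda j i * beta j ^- n) :
  exists N0 : nat, forall N : nat, (N0 <= N)%N ->
    discrepancy N (LSpoint k L b) <=
      (ln N.+1%:R - ln (cmod (lambda 1%N 0%N * (b%:C)%C ^+ k))) / (N%:R * `|ln b|)
      * (2 * (L 1%N)%:R + \sum_(2 <= i < k.+1) (L i)%:R - 2)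
      * Rtilde k L beta lambda.
Proof.
have [hb0 hb1] := andP hb.
have hL1 : (0 < L 1)%N by move: hL; case: (L 1%N).
have hroot : \sum_(1 <= r < k.+1) (L r)%:R * b ^+ r = 1.
  by apply/LSpoly_root/hroots; exists 1%N; rewrite ?hk // hbeta1.
have hS := Lsum_gt1 hb hroot.
set E := piece_error k L beta lambda.
have E0 : 0 <= E by apply: (@piece_error_ge0 k L hk hL1 R b) => //.
set F : R := (L 1 + Lsum L k - 2)%:R.
have FE : 2 * (L 1%N)%:R + \sum_(2 <= i < k.+1) (L i)%:R - 2 = F.
  rewrite /F natrB; last by rewrite -[2%N]/(1 + 1)%N leq_add // ltnW.
  rewrite natrD /Lsum (big_ltn (m := 1)) // natrD natr_sum; ring.
have F1 : 1 <= F.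
  rewrite (ler_nat _ 1) leq_subRL; first by rewrite addn1 -[3%N]/(1 + 2)%N leq_add.
  by rewrite -[2%N]/(1 + 1)%N leq_add // ltnW.
set c0 := ln (cmod _).
set D := `|ln b|.
have D0 : 0 < D by rewrite normr_gt0 lt_eqF // ln_lt0.
set K := 2 * (E + lambda0_sum k lambda) + 1.
(* Everything independent of [N], in the form [linear_absorb] asks for; [c0] may have either sign,
   hence the absolute value. *)
set A := k%:R * F * E + K + `|c0 / D| * F * (1 + E).
pose n0 := Num.bound `|A|.
have An0 n : (n0 <= n)%N -> A <= n%:R.
  move=> nn0; apply: le_trans (ler_norm _) _.
  by apply: le_trans (ltW (archi_boundP (normr_ge0 A))) _; rewrite ler_nat.
(* [N >= t_{n0}] forces the level of [N] to be at least [n0], hence at least [A]. *)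
exists (tnum k L n0) => N leN.
have N0 : (0 < N)%N by apply: leq_trans leN; apply: leq_trans (ltn_tnum hk hL1 n0 hS).
have /andP[tN Nt] := level_spec hk hL1 hS N0.
have n0n := level_geq hk hL1 hS leN.
set n := level k L N in tN Nt n0n.
rewrite Rtilde_piece_error -/E FE /discrepancy.
apply: ge_sup.
  by eexists; exists 0, 1; split.
move=> _ [a [c [a0 ac c1 ->]]].
have NR : 0 < N%:R :> R by rewrite ltr0n.
have -> : N%:R^-1 * (\sum_(1 <= i < N.+1) (LSpoint k L b i \in `[a, c[)%:R) - (c - a)
    = N%:R^-1 * (\sum_(1 <= i < N.+1) (LSpoint k L b i \in `[a, c[)%:R - N%:R * (c - a)).
  by rewrite mulrBr mulKf // gt_eqF.
rewrite normrM gtr0_norm ?invr_gt0 //.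
have -> : (ln N.+1%:R - c0) / (N%:R * D) * F * (1 + E)
    = N%:R^-1 * ((ln N.+1%:R - c0) / D * F * (1 + E)).
  by field; rewrite !gt_eqF.
rewrite ler_pM2l ?invr_gt0 //.
have lb := @local_discrepancy_bound k L hk hL1 R b hb0 hroot beta lambda.
apply: le_trans (lb hb1 hS hbeta1 hbeta hlambda n N a c Nt a0 ac c1) _.
rewrite -addrA natrD; apply: linear_absorb (An0 n n0n) => //.
(* With [n <= ln (N + 1) / D], the main factor is at least [n - c0 / D]. *)
rewrite mulrBl lerD2r ler_pdivlMr //.
exact: (@level_ln_le k L hk hL1 R b).
Qed.
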